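(* Let $\Gamma$ be a nonamenable countable discrete group. Then for any topological $\Gamma$-system $\Gamma\curvearrowright^a X$ we have $h^{\mathrm{tp}}_{\mathrm{nv}}(\Gamma\curvearrowright^a X)\in\{0,\infty\}$.
   Context: A topological $\Gamma$-system $\Gamma \curvearrowright^a X$ consists of a compact metrizable space $X$ and a homomorphism $a:\Gamma\to \mathrm{Homeo}(X)$; write $\gamma^a$ for $a(\gamma)$. Naive topological entropy. For an open cover $\mathscr{U}$ of $X$, $N(\mathscr{U})$ is the minimal cardinality of a subcover. The join of finitely many open covers is the cover consisting of all intersections of one element from each. Put $\gamma^a\mathscr{U}=\{\gamma^a U: U\in\mathscr{U}\}$ and, for finite $F\subseteq\Gamma$, $\mathscr{U}^F=\bigvee_{\gamma\in F}\gamma^a\mathscr{U}$. Define $h^{\mathrm{tp}}_{\mathrm{nv}}(\mathscr{U})=\inf_F \frac{1}{|F|}\log N(\mathscr{U}^F)$, the infimum over all nonempty finite $F\subseteq\Gamma$, and $h^{\mathrm{tp}}_{\mathrm{nv}}(\Gamma\curvearrowright^a X)=\sup\{h^{\mathrm{tp}}_{\mathrm{nv}}(\mathscr{U}) : \mathscr{U}\text{ a finite open cover of }X\}$. *)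

(* Defs.v *)
From HB Require Import structures.
From mathcomp Require Import all_boot all_order all_algebra finmap.
From mathcomp Require Import all_classical all_reals all_analysis.

Set Implicit Arguments.
Unset Strict Implicit.
Unset Printing Implicit Defensive.

Import Order.TTheory GRing.Theory Num.Theory.

Local Open Scope classical_set_scope.
Local Open Scope ring_scope.

(* Amenability of a discrete group, in von Neumann's form: a left-invariant
   finitely additive probability measure defined on all subsets. *)
Definition amenable (R : realType) (G : groupType) : Prop :=
  exists mu : set G -> R,
    [/\ forall A, 0 <= mu A,
        mu [set: G] = 1,
        forall A B, A `&` B = set0 -> mu (A `|` B) = mu A + mu B
      & forall g A, mu [set (g * x)%g | x in A] = mu A].

Definition is_metric (R : realType) (X : Type) (d : X -> X -> R) : Prop :=
  [/\ forall x y, 0 <= d x y,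
      forall x y, d x y = 0 <-> x = y,
      forall x y, d x y = d y x
    & forall x y z, d x z <= d x y + d y z].

Definition metrizable (R : realType) (X : topologicalType) : Prop :=
  exists2 d : X -> X -> R, is_metric d &
    forall A : set X, open A <->
      forall x, A x -> exists2 e : R, 0 < e & [set y | d x y < e] `<=` A.

Definition homeomorphism (X Y : topologicalType) (f : X -> Y) : Prop :=
  exists g : Y -> X,
    [/\ cancel f g, cancel g f, continuous f & continuous g].

(* [a] is a group homomorphism from [G] to the homeomorphisms of [X] under
   composition (so [a 1%g = id] and [a g^-1%g] is the inverse of [a g]). *)
Definition homeo_action (G : groupType) (X : topologicalType)
    (a : G -> X -> X) : Prop :=
  (forall g, homeomorphism (a g)) /\ (forall g h, a (g * h)%g = a g \o a h).

Definition topological_system (R : realType) (G : groupType)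
    (X : topologicalType) (a : G -> X -> X) : Prop :=
  [/\ compact [set: X], metrizable R X & homeo_action a].

(* Covers are sets of subsets, not indexed families. *)
Definition is_cover (X : Type) (U : set (set X)) : Prop :=
  \bigcup_(A in U) A = [set: X].

Definition open_cover (X : topologicalType) (U : set (set X)) : Prop :=
  (forall A, U A -> open A) /\ is_cover U.

Definition subcover_of_card (X : Type) (U : set (set X)) (n : nat) : Prop :=
  exists V : set (set X), [/\ V `<=` U, is_cover V & (V #= `I_n)%card].

(* The default value chosen by [get] is only used when [U] has no finite
   subcover. *)
Definition cover_number (X : Type) (U : set (set X)) : nat :=
  [get n : nat | subcover_of_card U n /\
                 forall m : nat, subcover_of_card U m -> (n <= m)%N].

Definition cover_join (I X : Type) (D : set I) (C : I -> set (set X)) :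
    set (set X) :=
  [set \bigcap_(i in D) f i | f in [set f | forall i, D i -> C i (f i)]].

Definition cover_translate (G : groupType) (X : Type) (a : G -> X -> X)
    (g : G) (U : set (set X)) : set (set X) :=
  [set a g @` A | A in U].

Definition cover_power (G : groupType) (X : Type) (a : G -> X -> X)
    (U : set (set X)) (F : {fset G}) : set (set X) :=
  cover_join [set` F] (fun g => cover_translate a g U).

(* [ln 0 = 0], so for the empty space (where [cover_number] is [0]) every
   quantity below is [0]. *)
Definition naive_entropy_cover (R : realType) (G : groupType) (X : Type)
    (a : G -> X -> X) (U : set (set X)) : \bar R :=
  ereal_inf [set (ln (cover_number (cover_power a U F))%:R / #|` F|%:R)%:E
            | F in [set F : {fset G} | F != fset0]].

Definition naive_entropy (R : realType) (G : groupType)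
    (X : topologicalType) (a : G -> X -> X) : \bar R :=
  ereal_sup [set naive_entropy_cover R a U
            | U in [set U : set (set X) | finite_set U /\ open_cover U]].

(* Main.v *)
Require Import Defs.
From HB Require Import structures.
From mathcomp Require Import all_boot all_order all_algebra finmap.
From mathcomp Require Import all_classical all_reals all_analysis.
From mathcomp Require Import lra.

Set Implicit Arguments.
Unset Strict Implicit.
Unset Printing Implicit Defensive.

Import Order.TTheory GRing.Theory Num.Theory.
Import numFieldNormedType.Exports.

Local Open Scope classical_set_scope.
Local Open Scope ring_scope.

(** Failure of the Folner condition amplifies to expansion by an arbitrary
    factor: for every [C] some finite [S] satisfies [#|F S| >= C #|F|] for all
    finite [F]. If a finite open cover [U] has entropy [h > 0], then
    [log N(U^E) >= h #|E|] for all finite [E]. The cover [(U^S)^F] refines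
    [U^(F S)], so [log N((U^S)^F) >= h #|F S| >= C h #|F|]: the cover [U^S] has
    entropy at least [C h], with [C] arbitrary. *)

(** * Limits of bounded functions along ultrafilters *)

Lemma fmap_ultra (T U : Type) (f : T -> U) (F : set_system T) :
  UltraFilter F -> UltraFilter (f @ F).
Proof.
move=> UF; split; first exact: fmap_proper_filter.
move=> H PH sub; apply/seteqP; split=> // A HA.
have [//|FnA] := in_ultra_setVsetC (f @^-1` A) UF.
have HnA : H (~` A) by apply: sub.
by have [] := @filter_not_empty _ H _; rewrite -(setICr A); apply: filterI.
Qed.

(** The image ultrafilter contains the compact segment from [a] to [b], hence converges there. These
    limits will define the invariant mean. *)
Lemma bounded_ultra_cvg (R : realType) (T : Type) (F : set_system T)
    (f : T -> R) (a b : R) :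
  UltraFilter F -> (forall x, a <= f x <= b) -> exists l : R, f @ F --> l.
Proof.
move=> UF fab; have UfF := fmap_ultra f UF.
have := @segment_compact R a b; rewrite compact_ultra => /(_ _ UfF) [].
  by apply: nearW => x; rewrite /= in_itv /= fab.
by move=> l [_ fl]; exists l.
Qed.

(** * Folner sets and amenability *)

Section Folner.
Variables (R : realType) (G : groupType).
Implicit Types (S E F : {fset G}) (e : R) (A B : set G).

Lemma card_rtranslate E (g : G) :
  #|` [fset (x * g)%g | x in E]%fset| = #|` E|.
Proof. exact/card_imfset/mulIg. Qed.

Definition right_boundary (E : {fset G}) (g : G) : {fset G} :=
  [fset x in E | (x * g)%g \notin E]%fset.

Definition folner (S : {fset G}) (e : R) (E : {fset G}) : Prop :=
  E != fset0 /\
  forall g, g \in S -> #|` right_boundary E g|%:R <= e * #|` E|%:R.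

(* Inverting turns right translates of [E], which the expansion argument
   needs, into the left translates of [A] in the definition of amenability. *)
Definition inv_density (A : set G) (E : {fset G}) : R :=
  #|` [fset x in E | `[< A x^-1%g >]]%fset|%:R / #|` E|%:R.

Lemma inv_density_itv A E : 0 <= inv_density A E <= 1.
Proof.
rewrite /inv_density divr_ge0 //=.
have [->|E0] := eqVneq E fset0; first by rewrite cardfs0 invr0 mulr0.
rewrite ler_pdivrMr ?ltr0n ?cardfs_gt0// mul1r ler_nat.
by apply: fsubset_leq_card; apply: fset_sub.
Qed.

Lemma inv_densityT E : E != fset0 -> inv_density setT E = 1.
Proof.
move=> E0; rewrite /inv_density.
have -> : [fset x in E | `[< [set: G] x^-1%g >]]%fset = E.
  by apply/fsetP => x; rewrite !inE /= asboolT// andbT.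
by rewrite divff// pnatr_eq0 cardfs_eq0.
Qed.

Lemma inv_densityU A B E : A `&` B = set0 ->
  inv_density (A `|` B) E = inv_density A E + inv_density B E.
Proof.
move=> AB0; rewrite /inv_density -mulrDl -natrD -cardfsUI.
set AE := [fset x in E | `[< A _ >]]%fset.
set BE := [fset x in E | `[< B _ >]]%fset.
have -> : (AE `&` BE)%fset = fset0.
  apply/fsetP => x; rewrite !inE /=; apply/negP.
  case/andP => /andP[_ /asboolP Ax] /andP[_ /asboolP Bx].
  by have : (A `&` B) x^-1%g by []; rewrite AB0.
rewrite cardfs0 addn0; congr (_%:R / _); congr (#|` _|).
by apply/fsetP => x; rewrite !inE /= asbool_or andb_orr.
Qed.

(** If [x] is in [E] and [x^-1] is in [g A], then [(x g)^-1] is in [A]. Either [x g] stays in [E]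
    and is counted for [A], injectively in [x], or [x] lies in the right boundary. *)
Lemma inv_density_translate g A E :
  inv_density [set (g * x)%g | x in A] E <=
  inv_density A E + #|` right_boundary E g|%:R / #|` E|%:R.
Proof.
rewrite /inv_density -mulrDl ler_wpM2r ?invr_ge0// -natrD ler_nat.
set L := [fset x in E | _]%fset; set M := [fset x in E | _]%fset.
pose N := [fset x in L | (x * g)%g \in E]%fset.
have sub : (L `<=` N `|` right_boundary E g)%fset.
  apply/fsubsetP => x; rewrite !inE /= => /andP[xE ->].
  by rewrite xE /=; case: ((x * g)%g \in E).
apply: leq_trans (fsubset_leq_card sub) _.
rewrite cardfsU; apply: leq_trans (leq_subr _ _) _; rewrite leq_add2r.
rewrite -(card_rtranslate _ g).
apply: fsubset_leq_card; apply/fsubsetP => y /imfsetP[x /=].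
rewrite !inE /= => /andP[/andP[xE /asboolP[z Az zx]] xgE] ->.
rewrite xgE /=; apply/asboolP.
by rewrite invgM -zx mulKg.
Qed.

(** The collections of Folner sets for the pairs [(S, e)] form a filter base. Along an ultrafilter
    containing them the densities converge to [mu], and the boundary error of a translation tends to
    zero. *)
Lemma folner_amenable :
  (forall S e, 0 < e -> exists E, folner S e E) -> amenable R G.
Proof.
move=> folG.
pose D := [set p : {fset G} * R | 0 < p.2].
pose B (p : {fset G} * R) := [set E | folner p.1 p.2 E].
have FF : ProperFilter (filter_from D B).
  apply: filter_from_proper; last by move=> [S e] /(folG S)[E]; exists E.
  apply: filter_from_filter; first by exists (fset0, 1); rewrite /D /= ltr01.
  move=> [S e] [S' e']; rewrite /D /= => e0 e0'.
  exists ((S `|` S')%fset, Num.min e e'); rewrite /D /= ?lt_min ?e0//.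
  move=> E [/= E0 fE]; split; split => //= g gS.
    apply: le_trans (fE g _) _; first by rewrite inE gS.
    by rewrite ler_wpM2r// ge_min lexx.
  apply: le_trans (fE g _) _; first by rewrite inE gS orbT.
  by rewrite ler_wpM2r// ge_min lexx orbT.
have [U [UU FU]] := ultraFilterLemma FF.
have PU : ProperFilter U := @ultra_proper _ _ UU.
have /choice[mu muE] A : exists l : R, inv_density A @ U --> l.
  by have [l] := bounded_ultra_cvg UU (inv_density_itv A); exists l.
have folU S e : 0 < e -> U [set E | folner S e E].
  by move=> e0; apply: FU; exists (S, e).
have le_mu g A : mu [set (g * x)%g | x in A] <= mu A.
  apply/ler_addgt0Pr => e e0.
  rewrite -subr_ge0; apply: (cvgr_to_ge (F := U) (f := fun E =>
    inv_density A E + e - inv_density [set (g * x)%g | x in A] E)).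
    exact: cvgB (cvgD (muE A) (cvg_cst e)) (muE _).
  apply: filterS (folU [fset g]%fset e e0) => E [E0 /(_ g)].
  rewrite inE eqxx => /(_ isT) gE.
  rewrite /= subr_ge0; apply: le_trans (inv_density_translate g A E) _.
  by rewrite lerD2l ler_pdivrMr// ltr0n cardfs_gt0.
exists mu; split.
- move=> A; apply: cvgr_to_ge (muE A) _.
  by apply: nearW => E; have /andP[] := inv_density_itv A E.
- apply: (norm_cvg_unique (muE [set: G])); apply: cvg_near_cst.
  by apply: filterS (folU fset0 1 ltr01) => E [/inv_densityT].
- move=> A A' AA'; apply: (norm_cvg_unique (muE (A `|` A'))).
  rewrite (_ : inv_density _ = inv_density A \+ inv_density A').
    exact: cvgD (muE A) (muE A').
  by apply/funext => E; rewrite inv_densityU.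
(* The reverse inequality is [le_mu] for [g^-1] and the translate [g A]. *)
- move=> g A; apply/eqP; rewrite eq_le le_mu /=.
  have := le_mu g^-1%g [set (g * x)%g | x in A].
  rewrite image_comp /= (_ : _ @` A = A)//.
  by rewrite -[RHS]image_id; apply: eq_imagel => x _ /=; rewrite mulKg.
Qed.

(** * Expansion in nonamenable groups *)

Definition setprod (E S : {fset G}) : {fset G} :=
  [fset (x * s)%g | x in E, s in S]%fset.

(** A pair [S], [e] without Folner sets forces growth by [1 + e] under right multiplication by [T],
    which is [S] with [1] adjoined. Repeating this [n] times gives the factor [(1 + e) ^+ n], which
    is unbounded. *)
Lemma nonamenable_expansion : ~ amenable R G ->
  forall C : R, exists S, forall E, C * #|` E|%:R <= #|` setprod E S|%:R.
Proof.
move=> /(contra_not folner_amenable).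
move=> /existsNP[S /existsNP[e /not_implyP[e0 /forallNP nfol]]] C.
pose T := (1%g |` S)%fset.
have step E : (1 + e) * #|` E|%:R <= #|` setprod E T|%:R :> R.
  have [->|E0] := eqVneq E fset0; first by rewrite cardfs0 mulr0.
  have /not_andP[//|/existsNP[g /not_implyP[gS /negP]]] := nfol E.
  rewrite -ltNge => /ltW gE.
  rewrite mulrDl mul1r; apply: (le_trans (lerD (lexx _) gE)).
  rewrite -natrD ler_nat.
  (* The boundary moved by [g] is disjoint from [E]. Both sets lie in [E T]: [E] through [1], the
     moved boundary through [g]. *)
  rewrite -(card_rtranslate (right_boundary E g) g).
  set I := [fset (x * g)%g | x in _]%fset.
  have EI : (E `&` I)%fset = fset0.
    apply/fsetP => x; rewrite !inE; apply/negP => /andP[xE /imfsetP[y /=]].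
    by rewrite !inE /= => /andP[_ /negP ygE] xy; apply: ygE; rewrite -xy.
  rewrite -cardfsUI EI cardfs0 addn0; apply: fsubset_leq_card.
  apply/fsubsetP => x; rewrite inE => /orP[xE|/imfsetP[y /= yE ->]].
    by rewrite -[x]mulg1; apply: in_imfset2 => //=; rewrite !inE eqxx.
  apply: in_imfset2 => /=; last by rewrite !inE gS orbT.
  by move: yE; rewrite !inE => /andP[].
have iter n : exists S', forall E,
    (1 + e) ^+ n * #|` E|%:R <= #|` setprod E S'|%:R :> R.
  elim: n => [|n [S' IH]].
    exists [fset 1%g]%fset => E; rewrite expr0 mul1r ler_nat.
    apply: fsubset_leq_card; apply/fsubsetP => x xE.
    by rewrite -[x]mulg1; apply: in_imfset2 => //=; rewrite inE.
  exists (setprod S' T) => E.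
  have -> : setprod E (setprod S' T) = setprod (setprod E S') T.
    apply/fsetP => z; apply/imfset2P/imfset2P => /= -[x xE [y yE ->]].
      case/imfset2P: yE => /= s sS [t tT ->].
      exists (x * s)%g; first exact: in_imfset2.
      by exists t => //; rewrite mulgA.
    case/imfset2P: xE => /= u uE [s sS ->].
    exists u => //; exists (s * y)%g; first exact: in_imfset2.
    by rewrite mulgA.
  apply: le_trans (step _); rewrite exprS -mulrA ler_wpM2l// addr_ge0//.
  exact: ltW.
have [n nC] : exists n, C <= (1 + e) ^+ n.
  have bernoulli n : 1 + n%:R * e <= (1 + e) ^+ n.
    elim: n => [|n IH]; first by rewrite mul0r addr0.
    have : (1 + e) * (1 + n%:R * e) <= (1 + e) ^+ n.+1.
      by rewrite exprS ler_wpM2l// addr_ge0// ltW.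
    apply: le_trans; rewrite -natr1.
    have : 0 <= n%:R * e ^+ 2 by rewrite mulr_ge0// sqr_ge0.
    by nra.
  (* By Bernoulli, any [n] above [C / e] suffices. *)
  exists (Num.truncn (C / e)).+1; apply: le_trans (bernoulli _).
  have : C / e < (Num.truncn (C / e)).+1%:R by apply: truncnS_gt.
  by rewrite ltr_pdivrMr// => /ltW h; lra.
have [S' HS'] := iter n; exists S' => E; apply: le_trans (HS' E).
by rewrite ler_wpM2r.
Qed.

End Folner.

(** * Cover numbers, refinements and joins *)

(** A finite cover is a subcover of itself, so a minimum exists and [get] does not fall back on its
    default. *)
Lemma cover_number_spec (X : Type) (V : set (set X)) :
  finite_set V -> is_cover V ->
  subcover_of_card V (cover_number V) /\
  forall m, subcover_of_card V m -> (cover_number V <= m)%N.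
Proof.
move=> /finite_setP[n Vn] cV.
apply: (@getPex _ (fun n => subcover_of_card V n /\
  forall m, subcover_of_card V m -> (n <= m)%N)).
have exn : exists n, `[< subcover_of_card V n >].
  by exists n; apply/asboolP; exists V; split=> //; exact: subset_refl.
case: (ex_minnP exn) => m /asboolP Vm min_m.
by exists m; split => // k /asboolP; apply: min_m.
Qed.

(** Replacing each member of a minimal subcover of [W] by a member of [V] containing it gives a
    subcover of [V] with no more elements. *)
Lemma cover_number_refine (X : Type) (V W : set (set X)) :
  finite_set V -> is_cover V -> finite_set W -> is_cover W ->
  (forall B, W B -> exists2 A, V A & B `<=` A) ->
  (cover_number V <= cover_number W)%N.
Proof.
move=> fV cV fW cW refWV.
have [_ minV] := cover_number_spec fV cV.
have [[W' [W'W cW' W'n]] _] := cover_number_spec fW cW.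
have /choice[f fP] B : exists A, W B -> V A /\ B `<=` A.
  have [/refWV[A VA BA]|nWB] := pselect (W B); first by exists A.
  by exists set0.
have fW' : finite_set W' by apply: sub_finite_set fW.
have /finite_setP[m fW'm] : finite_set (f @` W') by exact: finite_image.
apply: (@leq_trans m).
  apply: minV; exists (f @` W'); split => //.
    by move=> _ [B /W'W WB <-]; have [] := fP B WB.
  apply/seteqP; split => // x _.
  have : (\bigcup_(A in W') A) x by rewrite cW'.
  move=> [B W'B Bx]; exists (f B); first by exists B.
  by have [_] := fP B (W'W _ W'B); apply.
rewrite -card_le_II -(card_le_eql fW'm) -(card_le_eqr W'n).
exact: card_image_le.
Qed.

Lemma is_cover_join (I X : Type) (D : set I) (C : I -> set (set X)) :
  (forall i, D i -> is_cover (C i)) -> is_cover (cover_join D C).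
Proof.
move=> cC; apply/seteqP; split => // x _.
have /choice[f fP] i : exists A, D i -> C i A /\ A x.
  have [/cC Ci|nDi] := pselect (D i); last by exists set0.
  by have : [set: X] x by []; rewrite -Ci => -[A CA Ax]; exists A.
exists (\bigcap_(i in D) f i).
  by exists f => // i /fP[].
by move=> i /fP[].
Qed.

Lemma finite_set_powerset (T : choiceType) (A : set T) :
  finite_set A -> finite_set [set B | B `<=` A].
Proof.
move=> /finite_fsetP[F ->].
apply: (@sub_finite_set _ _ [set [set` E] | E in [set` fpowerset F]]).
  move=> B /= BF; have fB := finite_subfset F BF.
  exists (fset_set B); last exact: fset_setK.
  rewrite /= fpowersetE; apply/fsubsetP => x.
  by rewrite in_fset_set// inE => /BF.
exact/finite_image/finite_fset.
Qed.

(** The choice functions are arbitrary off [D], so they are not counted directly. Instead, every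
    member of the join is the intersection of a subfamily of the finite union of the [C i]. *)
Lemma finite_cover_join (I X : Type) (D : set I) (C : I -> set (set X)) :
  finite_set D -> (forall i, D i -> finite_set (C i)) ->
  finite_set (cover_join D C).
Proof.
move=> fD fC; pose W := \bigcup_(i in D) C i.
have fW : finite_set W by apply: bigcup_finite.
apply: (@sub_finite_set _ _
  ((fun V : set (set X) => \bigcap_(A in V) A) @` [set V | V `<=` W])).
  move=> _ [f fC' <-]; exists (f @` D); last by rewrite bigcap_image.
  by move=> _ [i Di <-]; exists i => //; exact: fC'.
exact/finite_image/finite_set_powerset.
Qed.

Lemma open_cover_join (I : choiceType) (X : topologicalType) (D : set I)
    (C : I -> set (set X)) :
  finite_set D -> (forall i, D i -> open_cover (C i)) ->
  open_cover (cover_join D C).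
Proof.
move=> fD oC; split; last by apply: is_cover_join => i /oC[].
move=> _ [f fP <-]; rewrite -closedC setC_bigcap.
apply: closed_bigcup => // i Di; rewrite closedC.
by have [+ _] := oC i Di; apply; exact: fP.
Qed.

Lemma ln_natr_ge0 (R : realType) n : 0 <= ln n%:R :> R.
Proof. by case: n => [|n]; [rewrite ln0 | rewrite ln_ge0// ler1n]. Qed.

Lemma ln_natr_le (R : realType) m n : (m <= n)%N -> ln m%:R <= ln n%:R :> R.
Proof.
case: m => [_|m mn]; first by rewrite ln0// ln_natr_ge0.
by rewrite ler_ln ?posrE ?ltr0n ?(leq_trans _ mn)// ler_nat.
Qed.

(** * Powers of covers and their entropy *)

Section System.
Variables (R : realType) (G : groupType) (X : topologicalType).
Variable a : G -> X -> X.
Hypothesis act : homeo_action a.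
Implicit Types (U : set (set X)) (S F : {fset G}).

Lemma open_cover_translate U g : open_cover U ->
  open_cover (cover_translate a g U).
Proof.
have [h [ha ah _ ch]] := act.1 g.
move=> [oU cU]; split.
  move=> _ [A UA <-].
  rewrite (_ : _ @` _ = h @^-1` A); first by apply: open_comp => //; exact: oU.
  apply/seteqP; split => [_ [x Ax <-] /=|x /= Ax]; first by rewrite ha.
  by exists (h x).
apply/seteqP; split => // x _.
have : [set: X] (h x) by [].
rewrite -cU => -[A UA Ahx]; exists (a g @` A); first by exists A.
by exists (h x).
Qed.

Lemma open_cover_power U F : open_cover U -> open_cover (cover_power a U F).
Proof.
move=> oU; apply: open_cover_join => // g _; exact: open_cover_translate.
Qed.

Lemma finite_cover_power U F : finite_set U -> finite_set (cover_power a U F).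
Proof. by move=> fU; apply: finite_cover_join => // g _; apply: finite_image. Qed.

(** For [x] in [F] and [s] in [S], the factor of [B] at [x] is the [x]-translate of an intersection
    whose factor at [s] is some [s A], so [B] lies in [(x s) A]. An element [z] of [F S] may factor
    in several ways; one factorization per [z] determines the member of the coarser cover. *)
Lemma cover_power_refine U F S B :
  cover_power a (cover_power a U S) F B ->
  exists2 A, cover_power a U (setprod F S) A & B `<=` A.
Proof.
move=> [f fP <-].
have /choice[k kP] z : exists A, (z \in setprod F S) ->
    cover_translate a z U A /\ \bigcap_(x in [set` F]) f x `<=` A.
  have [/imfset2P[/= x xF [s sS zE]]|_] := boolP (z \in setprod F S);
    last by exists set0.
  have [_ [u uP <-] fx] := fP x xF.
  have [A UA uA] := uP s sS.
  exists (a z @` A); split; first by exists A.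
  move=> y /(_ x xF); rewrite -fx => -[t /(_ s sS)].
  rewrite -uA => -[t' At' <-] <-.
  by exists t' => //; rewrite zE act.2.
exists (\bigcap_(z in [set` setprod F S]) k z).
  by exists k => // z /= /kP[].
by move=> y yB z /= /kP[_]; apply.
Qed.

Lemma naive_entropy_cover_ge0 U : (0 <= naive_entropy_cover R a U)%E.
Proof.
apply: le_ereal_inf_tmp => _ [F _ <-].
by rewrite lee_fin divr_ge0// ln_natr_ge0.
Qed.

Lemma naive_entropy_cover_fin_num U : naive_entropy_cover R a U \is a fin_num.
Proof.
rewrite ge0_fin_numE ?naive_entropy_cover_ge0//.
apply: le_lt_trans (ltry _); apply: ereal_inf_lbound.
exists [fset 1%g]%fset => //=.
by rewrite -cardfs_gt0 cardfs1.
Qed.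

Lemma naive_entropy_cover_power U S (C : R) :
  finite_set U -> open_cover U -> 0 < C ->
  (forall F, C * #|` F|%:R <= #|` setprod F S|%:R) ->
  (C%:E * naive_entropy_cover R a U <=
   naive_entropy_cover R a (cover_power a U S))%E.
Proof.
move=> fU oU C0 CS.
have hE := fineK (naive_entropy_cover_fin_num U); set h := fine _ in hE.
have h0 : 0 <= h by rewrite fine_ge0// naive_entropy_cover_ge0.
rewrite -hE; apply: le_ereal_inf_tmp => _ [F F0 <-]; rewrite -EFinM lee_fin.
have F0' : 0 < #|` F|%:R :> R by rewrite ltr0n cardfs_gt0.
rewrite ler_pdivlMr//.
(* Positivity of [C] makes [F S] nonempty, hence admissible in the infimum defining the entropy of
   [U]. *)
have FS0 : 0 < #|` setprod F S|%:R :> R.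
  by apply: lt_le_trans (CS F); rewrite mulr_gt0.
have hFS : h * #|` setprod F S|%:R <=
    ln (cover_number (cover_power a U (setprod F S)))%:R.
  rewrite -ler_pdivlMr// -lee_fin hE.
  apply: ereal_inf_lbound; exists (setprod F S) => //=.
  by rewrite -cardfs_gt0 -(ltr0n R).
rewrite -mulrA mulrCA; apply: le_trans (ler_wpM2l h0 (CS F)) _.
apply: le_trans hFS _.
have fUS := finite_cover_power S fU; have oUS := open_cover_power S oU.
apply: ln_natr_le; apply: cover_number_refine; last exact: cover_power_refine.
- exact: finite_cover_power.
- by have [] := open_cover_power (setprod F S) oU.
- exact: finite_cover_power.
- by have [] := open_cover_power F oUS.
Qed.

End System.

(** * The dichotomy between zero and infinite entropy *)

Theorem mainTheorem6 (R : realType) (Gamma : groupType)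
    (Gamma_countable : countable [set: Gamma])
    (Gamma_nonamenable : ~ amenable R Gamma)
    (X : topologicalType) (a : Gamma -> X -> X)
    (a_system : topological_system R a) :
  naive_entropy R a = 0%E \/ naive_entropy R a = +oo%E.
Proof.
have [_ _ act] := a_system.
have ge0 : (0 <= naive_entropy R a)%E.
  apply: le_trans (naive_entropy_cover_ge0 R a [set [set: X]]) _.
  apply: ereal_sup_ubound; exists [set [set: X]] => //; split => //.
  split; first by move=> _ ->; exact: openT.
  by rewrite /is_cover bigcup_set1.
have [le0|] := leP (naive_entropy R a) 0%E.
  by left; apply/eqP; rewrite eq_le le0.
move=> /ereal_sup_gt[_ [U [fU oU] <-] hU]; right.
apply/eqyP => M M0.
have hE := fineK (naive_entropy_cover_fin_num R a U); set h := fine _ in hE.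
have h0 : 0 < h by rewrite -lte_fin hE.
have C0 : 0 < M / h by rewrite divr_gt0.
(* The expansion factor is chosen to raise the positive finite entropy [h] of [U] to the arbitrary
   bound [M]. *)
have [S CS] := nonamenable_expansion Gamma_nonamenable (M / h).
have := naive_entropy_cover_power act fU oU C0 CS.
rewrite -hE -EFinM divfK ?gt_eqF// => MU.
apply: le_trans MU _; apply: ereal_sup_ubound.
exists (cover_power a U S) => //; split; first exact: finite_cover_power.
exact: open_cover_power.
Qed.
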